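(* If $T$ is a tree of order $n\ge 3$, then $\xi^d(T)-\xi^c(T)\ge 4n^2-12n+8$. Moreover, equality holds if and only if $T=S_n$.
   Context: For a vertex $v$ of a tree $T$: $\deg(v)$ is its degree, $\varepsilon(v)=\max_{u} d(v,u)$ its eccentricity, $D(v)=\sum_u d(v,u)$ its total distance ($d$ the path distance). $\xi^c(T)=\sum_v \varepsilon(v)\deg(v)$ and $\xi^d(T)=\sum_v\varepsilon(v)D(v)$. $S_n=K_{1,n-1}$ is the star of order $n$. *)

(* Defs.v *)
From mathcomp Require Import all_boot all_order all_algebra.

Set Implicit Arguments.
Unset Strict Implicit.
Unset Printing Implicit Defensive.

Section Graph.
Variables (V : finType) (e : rel V).

Definition simple_graph : Prop := symmetric e /\ irreflexive e.

Definition connected : Prop := 0 < #|V| /\ forall x y, connect e x y.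

(* [ucycle e c] also holds for the empty sequence and, by symmetry of e, for
   the two endpoints of an edge; graph cycles have at least 3 vertices. *)
Definition acyclic : Prop := forall c : seq V, ucycle e c -> size c <= 2.

Definition is_tree : Prop := [/\ simple_graph, connected & acyclic].

Definition has_path_of_length (x y : V) (k : nat) : bool :=
  [exists p : k.-tuple V, [&& path e x p, uniq (x :: p) & last x p == y]].

(* The least length of a path from x to y. Such a length is < #|V|, so the
   search is exhaustive; the value is #|V| when no path exists. *)
Definition dist (x y : V) : nat :=
  find (has_path_of_length x y) (iota 0 #|V|).

Definition deg (v : V) : nat := #|[set u | e v u]|.

Definition ecc (v : V) : nat := \max_(u : V) dist v u.

Definition total_dist (v : V) : nat := \sum_(u : V) dist v u.

Definition xi_c : nat := \sum_(v : V) ecc v * deg v.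

Definition xi_d : nat := \sum_(v : V) ecc v * total_dist v.

End Graph.

Definition graph_iso (V W : finType) (e : rel V) (e' : rel W) : Prop :=
  exists2 f : V -> W, bijective f & forall x y, e x y = e' (f x) (f y).

Definition complete_bipartite (a b : nat) : rel ('I_a + 'I_b)%type :=
  fun x y => match x, y with
             | inl _, inr _ | inr _, inl _ => true
             | _, _ => false
             end.
Arguments complete_bipartite : clear implicits.

Definition star (n : nat) : rel ('I_1 + 'I_n.-1)%type :=
  complete_bipartite 1 n.-1.
Arguments star : clear implicits.

(* Main.v *)
Require Import Defs.
From mathcomp Require Import all_boot all_order all_algebra.
From mathcomp Require Import zify.

Set Implicit Arguments.
Unset Strict Implicit.
Unset Printing Implicit Defensive.

(** Write n for the order. A vertex v has deg v vertices at distance 1, all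
    remaining ones being at distance at least 2, so D(v) + deg v >= 2(n - 1).
    Multiplying by the eccentricity, which is at least 2 unless deg v = n - 1,
    gives ecc v * (D(v) - deg v) >= 4 (n - 1 - deg v), with equality exactly when
    ecc v <= 2. Summing over v and bounding the degree sum of a tree by
    2(n - 1) yields the inequality; equality forces diameter at most 2, and the
    trees of diameter at most 2 are the stars. *)

(** * Distances as lengths of shortest walks *)

Section Distance.
Variables (V : finType) (e : rel V).

Lemma has_pathP (x y : V) (k : nat) :
  reflect (exists p, [/\ path e x p, uniq (x :: p), last x p = y & size p = k])
          (has_path_of_length e x y k).
Proof.
apply: (iffP existsP) => [[p /and3P[ep Up /eqP lp]]|[p [ep Up lp sp]]].
  by exists p; rewrite size_tuple.
by rewrite -sp; exists (in_tuple p); rewrite ep Up lp eqxx.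
Qed.

Lemma size_uniq_lt_card (x : V) (p : seq V) : uniq (x :: p) -> size p < #|V|.
Proof. by move=> /card_uniqP Up; have := max_card (mem (x :: p)); rewrite Up. Qed.

(** The walk shortens to a simple path, whose length lies in the range searched by [dist] and so
    bounds the first hit. *)
Lemma dist_le_size (x y : V) (p : seq V) :
  path e x p -> last x p = y -> dist e x y <= size p.
Proof.
move=> ep lp; case: (shortenP ep) lp => q eq Uq sub_qp lq.
have le_qp : size q <= size p.
  by case/andP: Uq => _ /uniq_leq_size; apply=> z /sub_qp.
apply: leq_trans le_qp; rewrite leqNgt; apply/negP => lt_d.
have := before_find 0 lt_d; rewrite nth_iota ?(size_uniq_lt_card Uq) // add0n.
by move/has_pathP; apply; exists q.
Qed.

(** Shortening a walk puts [dist] below [#|V|], so the search succeeds and its hit carries a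
    path. *)
Lemma shortest_path (x y : V) : connect e x y ->
  exists p, [/\ path e x p, last x p = y & size p = dist e x y].
Proof.
case/connectP=> q eq lq.
have lt_dV : dist e x y < #|V|.
  case/shortenP: eq lq => p ep Up _ lp.
  by apply: leq_ltn_trans (size_uniq_lt_card Up); apply: dist_le_size.
have has_d : has (has_path_of_length e x y) (iota 0 #|V|).
  by rewrite has_find size_iota.
have := nth_find 0 has_d; rewrite nth_iota ?(size_uniq_lt_card Uq) // add0n.
by move=> /has_pathP[p [ep _ lp sp]]; exists p.
Qed.

Lemma dist_leP (x y : V) (k : nat) :
  connect e x y ->
  reflect (exists p, [/\ path e x p, last x p = y & size p <= k]) (dist e x y <= k).
Proof.
move=> /shortest_path sxy; apply: (iffP idP) => [le_dk | [p [ep lp]]].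
  by case: sxy => p [ep lp sp]; exists p; rewrite sp.
exact: leq_trans (dist_le_size ep lp).
Qed.

End Distance.

(** * Small distances in connected graphs *)

Section Connected.
Variables (V : finType) (e : rel V).
Hypothesis connV : forall x y, connect e x y.

Lemma dist_le0 (x y : V) : (dist e x y <= 0) = (x == y).
Proof.
apply/dist_leP/eqP => // [[[|z p] []] //|->]; by exists [::].
Qed.

Lemma dist_le1 (x y : V) : (dist e x y <= 1) = (x == y) || e x y.
Proof.
apply/dist_leP/orP => // [[[|z [|? ?]] [] //=]|[/eqP->|exy]].
- by move=> _ ->; left.
- by rewrite andbT => exz <-; right.
- by exists [::].
- by exists [:: y]; rewrite /= exy.
Qed.

Lemma dist_le2P (x y : V) :
  reflect [\/ x = y, e x y | exists2 z, e x z & e z y] (dist e x y <= 2).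
Proof.
apply: (iffP (dist_leP _ (connV x y))) => [[[|z [|t [|? ?]]] [] //=]|].
- by move=> _ -> _; apply: Or31.
- by rewrite andbT => exz <- _; apply: Or32.
- by rewrite andbT => /andP[exz ezt] <- _; apply: Or33; exists z.
case=> [->|exy|[z exz ezy]].
- by exists [::].
- by exists [:: y]; rewrite /= exy.
- by exists [:: z; y]; rewrite /= exz ezy.
Qed.

Lemma closer_neighbour (x r : V) :
  x != r -> exists2 z, e x z & dist e z r < dist e x r.
Proof.
move=> neq_xr; have /(dist_leP _ (connV x r))[p [ep lp sp]] := leqnn (dist e x r).
case: p ep lp sp => [_ /= xr|z p /= /andP[exz ep] lp sp].
  by rewrite xr eqxx in neq_xr.
exists z => //; apply: leq_ltn_trans sp.
by apply/(dist_leP _ (connV z r)); exists p.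
Qed.

Lemma dist_le_ecc (x y : V) : dist e x y <= ecc e x.
Proof. exact: (leq_bigmax y). Qed.

Lemma ecc_le2P (x : V) : reflect (forall y, dist e x y <= 2) (ecc e x <= 2).
Proof.
apply: (iffP idP) => [le2 y|le2]; first exact: leq_trans (dist_le_ecc x y) le2.
exact/bigmax_leqP.
Qed.

(** * Degree, total distance and eccentricity *)

Hypothesis irrV : irreflexive e.

Lemma deg_sum (v : V) : deg e v = \sum_u e v u.
Proof.
rewrite /deg cardsE -sum1_card big_mkcond /=.
by apply: eq_bigr => u _; rewrite unfold_in; case: (e v u).
Qed.

(** Termwise, each [u] other than [v] contributes 1 + 1 if adjacent to [v] and its distance
    otherwise: at least 2, with equality iff that distance is at most 2. *)
Lemma total_dist_deg (v : V) :
  2 * #|V|.-1 <= total_dist e v + deg e v ?= iff (ecc e v <= 2).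
Proof.
have -> : 2 * #|V|.-1 = \sum_u 2 * (u != v).
  by rewrite -big_distrr /= -(cardC1 v) -sum1_card big_mkcond.
have -> : (ecc e v <= 2) = [forall u, dist e v u <= 2].
  by apply/ecc_le2P/forallP.
rewrite deg_sum -big_split; apply: leqif_sum => u _ /=.
have := dist_le0 v u; have := dist_le1 v u; rewrite eq_sym.
have [->|_] := eqVneq u v; first by rewrite irrV => _; case: (dist _ _ _).
case: (e v u) => /=; move: (dist _ _ _) => [|[|[|d]]] //= _ _.
Qed.

Lemma deg_le_pred_card (v : V) : deg e v <= #|V|.-1.
Proof.
rewrite -(cardC1 v) /deg cardsE; apply/subset_leq_card/subsetP => u.
by rewrite !inE unfold_in; apply: contraTneq => ->; rewrite irrV.
Qed.

Lemma ecc_lt2_deg (v : V) : ecc e v < 2 -> deg e v = #|V|.-1.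
Proof.
move=> ecc1; rewrite -(cardC1 v) /deg cardsE; apply: eq_card => u.
have /idP := leq_trans (dist_le_ecc v u) ecc1; rewrite dist_le1 !inE unfold_in.
by rewrite eq_sym; case: eqVneq => [->|_ /= ->]; rewrite ?irrV.
Qed.

Lemma ecc_total_dist_deg (v : V) :
  ecc e v * deg e v + 4 * #|V|.-1 <= ecc e v * total_dist e v + 4 * deg e v
    ?= iff (ecc e v <= 2).
Proof.
have [leD eqD] := total_dist_deg v; have le_deg := deg_le_pred_card v.
have := @ecc_lt2_deg v; move: le_deg.
move: (ecc e v) (deg e v) (total_dist e v) #|V|.-1 leD eqD => r k D m leD eqD le_km.
have [le_r2|lt_2r] := leqP r 2 => small.
  have {}eqD : D + k = 2 * m by apply/esym/eqP; rewrite eqD.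
  suff -> : r * k + 4 * m = r * D + 4 * k by apply/leqif_refl.
  (* For [r < 2] the vertex is adjacent to all others, so [D = k = m] and both sides agree whatever
     [r] is. *)
  have [/small k_m|r_gt1] := ltnP r 2.
    have -> : D = k by lia.
    by rewrite k_m.
  have -> : r = 2 by lia.
  lia.
have {}leD : 2 * m < D + k by rewrite ltn_neqAle eqD leD -ltnNge lt_2r.
have ltD : r * k + 4 * m < r * D + 4 * k.
  (* From [k <= m] and [2 * m < D + k] follows [D - k > 2 * (m - k)], so the subtraction is not
     truncated and the factor 3 already gives more than [4 * (m - k)]. *)
  have : 3 * (D - k) <= r * (D - k) by rewrite leq_mul2r lt_2r orbT.
  by rewrite [r * _]mulnBr; lia.
by split; [exact: ltnW | exact: ltn_eqF].
Qed.

(** The degree sum is kept as it is, to be bounded for trees and computed exactly for stars. *)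
Lemma xi_deg_sum :
  xi_c e + 4 * (#|V| * #|V|.-1) <= xi_d e + 4 * \sum_v deg e v
    ?= iff [forall v, ecc e v <= 2].
Proof.
have -> : 4 * (#|V| * #|V|.-1) = \sum_(v : V) 4 * #|V|.-1.
  by rewrite sum_nat_const mulnCA.
rewrite big_distrr -!big_split; apply: leqif_sum => v _.
exact: ecc_total_dist_deg.
Qed.

End Connected.

(** * Rooted trees and their degree sum *)

Section Tree.
Variables (V : finType) (e : rel V).
Hypothesis treeV : is_tree e.

Let symV : symmetric e. Proof. by case: treeV => -[]. Qed.
Let irrV : irreflexive e. Proof. by case: treeV => -[]. Qed.
Let connV : forall x y, connect e x y. Proof. by case: treeV => _ []. Qed.
Let acyclicV : acyclic e. Proof. by case: treeV. Qed.

Definition without_edge (x y : V) : rel V :=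
  [rel u v | e u v && ~~ ((u == x) && (v == y) || (u == y) && (v == x))].

(** A simple path avoiding the edge would close up with it to a cycle. Acyclicity leaves only a path
    of length at most 1, which is a loop or the deleted edge. *)
Lemma tree_edge_bridge (x y : V) : e x y -> ~~ connect (without_edge x y) x y.
Proof.
move=> exy; apply/negP => /connectP[p0 ep0 lp0].
case/shortenP: ep0 lp0 => p ep Up _ yp.
have sub_e : subrel (without_edge x y) e by move=> u v /andP[].
have /acyclicV /= : ucycle e (x :: p).
  by rewrite /ucycle Up andbT /= rcons_path (sub_path sub_e ep) -yp symV.
case: p ep yp {Up} => [|z [|//]] /=; first by move=> _ yx; rewrite yx irrV in exy.
by rewrite /without_edge /= => + yz; rewrite yz !eqxx andbF.
Qed.

(** The next vertex on a way from [x] to the root [r]; at the root no neighbour is closer and the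
    default [x] is returned. *)
Definition parent (r x : V) : V :=
  odflt x [pick z | e x z && (dist e z r < dist e x r)].

Lemma parentP (r x : V) :
  x != r -> e x (parent r x) /\ dist e (parent r x) r < dist e x r.
Proof.
rewrite /parent => /(closer_neighbour connV)[z exz lt_z].
by case: pickP => [t /andP[] //|/(_ z)]; rewrite exz lt_z.
Qed.

(* Otherwise the parent walks from x and from y to the root avoid the edge xy,
   which is a bridge. *)
Lemma tree_edge_parent (r x y : V) : e x y ->
  (x != r) && (y == parent r x) || (y != r) && (x == parent r y).
Proof.
move=> exy; apply: contraT; rewrite negb_or => /andP[not_xy not_yx].
have sym_w : symmetric (without_edge x y).
  by move=> u v; rewrite /without_edge /= symV orbC ![(v == _) && _]andbC.
have to_root k z : dist e z r < k -> connect (without_edge x y) z r.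
  elim: k z => // k IHk z; have [-> //|z_r] := eqVneq z r.
  have [ezp lt_p] := parentP z_r => lt_z.
  apply: connect_trans (connect1 _) (IHk _ (leq_trans lt_p lt_z)).
  rewrite /without_edge /= ezp negb_or /=.
  apply/andP; split; apply/negP => /andP[/eqP z_ /eqP p_].
    by move: not_xy; rewrite -z_ z_r p_ eqxx.
  by move: not_yx; rewrite -z_ z_r p_ eqxx.
have := tree_edge_bridge exy; rewrite (connect_trans (to_root _ x (ltnSn _))) //.
by rewrite (sym_connect_sym sym_w) (to_root _ y (ltnSn _)).
Qed.

(** The degree sum counts ordered adjacent pairs, and each pairs a non-root vertex with its parent,
    in one of two orders. *)
Lemma tree_deg_sum : \sum_v deg e v <= 2 * #|V|.-1.
Proof.
have [r _] : exists r : V, true by case: treeV => _ [/card_gt0P[r _] _] _; exists r.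
pose up := [set (x, parent r x) | x in predC1 r].
pose down := [set (parent r x, x) | x in predC1 r].
have -> : \sum_v deg e v = #|[set p : V * V | e p.1 p.2]|.
  under eq_bigr do rewrite deg_sum.
  rewrite pair_big /= cardsE -sum1_card big_mkcond /=.
  rewrite [RHS]big_mkcond /=.
  by apply: eq_bigr => p _; rewrite unfold_in; case: (e _ _).
have sub_updown : [set p : V * V | e p.1 p.2] \subset up :|: down.
  apply/subsetP => -[x y]; rewrite inE /=.
  move=> /(tree_edge_parent r) /orP[] /andP[nr /eqP pE].
    by rewrite inE; apply/orP; left; apply/imsetP; exists x; rewrite ?inE // -pE.
  by rewrite inE; apply/orP; right; apply/imsetP; exists y; rewrite ?inE // -pE.
apply: leq_trans (subset_leq_card sub_updown) _.
apply: leq_trans (leq_card_setU _ _) _.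
by rewrite mul2n -addnn -(cardC1 r) leq_add // leq_imset_card.
Qed.

(** With n the order, the constant is 4n(n - 1) less 4 times the degree bound 2(n - 1). *)
Lemma tree_xi : xi_c e + 4 * (#|V|.-1 * #|V|.-2) <= xi_d e.
Proof.
have [le_xi _] := xi_deg_sum connV irrV; have := tree_deg_sum.
by move: le_xi; case: treeV => _ [+ _] _; nia.
Qed.

(** Since the degree sum is at most 2(n - 1), equality here forces equality in [xi_deg_sum]. *)
Lemma tree_xi_eq : xi_d e = xi_c e + 4 * (#|V|.-1 * #|V|.-2) ->
  forall x y, dist e x y <= 2.
Proof.
move=> xiE x y; have [le_xi eq_xi] := xi_deg_sum connV irrV.
suff /forallP/(_ x)/ecc_le2P : [forall v, ecc e v <= 2] by apply.
rewrite -eq_xi; apply/eqP; have := tree_deg_sum.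
by move: le_xi xiE; case: treeV => _ [+ _] _; nia.
Qed.

(** * Trees of diameter at most 2 *)

Lemma edge_neq (x y : V) : e x y -> x != y.
Proof. by apply: contraTneq => ->; rewrite irrV. Qed.

Lemma tree_no_triangle (x y z : V) : e x y -> e y z -> ~~ e z x.
Proof.
move=> exy eyz; apply/negP => ezx.
suff /acyclicV : ucycle e [:: x; y; z] by [].
rewrite /ucycle /= exy eyz ezx !inE negb_or.
by rewrite !edge_neq // symV.
Qed.

(* The middle vertex z of a path of length 2 is a center: a vertex u not adjacent
   to z would be at distance at most 2 from every neighbour of z, so joining u to
   two of them closes a cycle of length at most 5. *)
Lemma diam2_tree_center : (forall x y, dist e x y <= 2) ->
  exists c, forall u, u != c -> e c u.
Proof.
move=> diam2; have [r _] : exists r : V, true.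
  by case: treeV => _ [/card_gt0P[r _] _] _; exists r.
have [/forallP adj|/forallPn[x]] := boolP [forall x, (x == r) || e r x].
  by exists r => x x_r; have := adj x; rewrite (negbTE x_r).
rewrite negb_or => /andP[x_r not_rx].
case/(dist_le2P connV): (diam2 r x) => [rx|rx|[z erz ezx]].
- by rewrite rx eqxx in x_r.
- by rewrite rx in not_rx.
exists z => u u_z; apply: contraT => not_zu.
case/(dist_le2P connV): (diam2 z u) => [zu|zu|[w ezw ewu]].
- by rewrite zu eqxx in u_z.
- by rewrite zu in not_zu.
(* [r] and [x] are distinct neighbours of [z], so one of them differs from [w]. *)
have [a eza a_w] : exists2 a, e z a & a != w.
  have [xw|] := eqVneq x w; last by exists x.
  by exists r; rewrite 1?symV // -xw eq_sym.
have a_u : a != u by apply: contraNneq not_zu => <-.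
have eaz : e a z by rewrite symV.
case/(dist_le2P connV): (diam2 a u) => [au|eau|[t eat etu]].
- by rewrite au eqxx in a_u.
- suff /acyclicV : ucycle e [:: z; w; u; a] by [].
  have eua : e u a by rewrite symV.
  rewrite /ucycle /= ezw ewu eua eaz !inE !negb_or.
  rewrite (edge_neq ezw) (edge_neq eza) (edge_neq ewu) (edge_neq eua).
  by rewrite eq_sym u_z eq_sym a_w.
have t_w : t != w.
  by apply: contraTneq eaz => tw; rewrite (tree_no_triangle ezw) // -tw symV.
have t_z : t != z by apply: contraNneq not_zu => <-.
suff /acyclicV : ucycle e [:: z; w; u; t; a] by [].
have eut : e u t by rewrite symV.
have eta : e t a by rewrite symV.
rewrite /ucycle /= ezw ewu eut eta eaz !inE !negb_or.
rewrite (edge_neq ezw) (edge_neq eza) (edge_neq ewu) (edge_neq eut) (edge_neq eta).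
by rewrite ![z == _]eq_sym ![w == _]eq_sym ![u == a]eq_sym u_z t_z t_w a_w a_u.
Qed.

(** The exclusive or makes exactly one endpoint the center; an edge between two other vertices would
    form a triangle with [c]. *)
Lemma diam2_tree_star : (forall x y, dist e x y <= 2) ->
  exists c, forall x y, e x y = (x == c) (+) (y == c).
Proof.
case/diam2_tree_center=> c adj; exists c => x y.
have [->|x_c] := eqVneq x c; have [->|y_c] /= := eqVneq y c.
- by rewrite irrV.
- by rewrite adj.
- by rewrite symV adj.
- apply/negP => exy; have := tree_no_triangle (adj x x_c) exy.
  by rewrite symV adj.
Qed.

End Tree.

(** * Stars: the equality case and isomorphism *)

Section Star.
Variables (V : finType) (e : rel V).

Section Center.
Variable c : V.
Hypothesis starV : forall x y, e x y = (x == c) (+) (y == c).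

Lemma star_irreflexive : irreflexive e.
Proof. by move=> x; rewrite starV addbb. Qed.

Lemma star_deg_sum : \sum_v deg e v = 2 * #|V|.-1.
Proof.
have degc : deg e c = #|V|.-1.
  rewrite -(cardC1 c) /deg cardsE; apply: eq_card => u.
  by rewrite !inE unfold_in starV eqxx; case: (u == c).
rewrite (bigD1 c) //= degc mul2n -addnn; congr (_ + _).
rewrite -(cardC1 c) -sum1_card; apply: eq_bigr => v v_c.
rewrite /deg cardsE -(card1 c); apply: eq_card => u.
by rewrite !inE unfold_in starV (negbTE v_c).
Qed.

(** All eccentricities are at most 2, so [xi_deg_sum] is an equality, and the degree sum is exactly
    2(n - 1). *)
Lemma star_xi : (forall x y, connect e x y) ->
  xi_d e = xi_c e + 4 * (#|V|.-1 * #|V|.-2).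
Proof.
move=> connV; have [_] := xi_deg_sum connV star_irreflexive.
have -> : [forall v, ecc e v <= 2].
  apply/forallP => x; apply/ecc_le2P => y; apply/(dist_le2P connV).
  rewrite starV; have [->|x_c] := eqVneq x c; have [->|y_c] /= := eqVneq y c.
  - exact: Or31.
  - exact: Or32.
  - exact: Or32.
  - by apply: Or33; exists c; rewrite starV eqxx ?(negbTE x_c) ?(negbTE y_c).
move/eqP; rewrite star_deg_sum.
have : 0 < #|V| by apply/card_gt0P; exists c.
nia.
Qed.

End Center.

Lemma star_isoP :
  (exists c, forall x y, e x y = (x == c) (+) (y == c)) <->
  0 < #|V| /\ graph_iso e (star #|V|).
Proof.
split=> [[c eE]|[_ [f [g fK gK] eE]]].
  have V_gt0 : 0 < #|V| by apply/card_gt0P; exists c.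
  split=> //.
  (* The left summand goes to the center, the right one enumerates the other vertices. Injectivity
     and equal cardinalities then make [g] bijective. *)
  pose g (a : 'I_1 + 'I_#|V|.-1) : V :=
    if a is inr i then enum_val (cast_ord (esym (cardC1 c)) i) else c.
  have g_inr i : (g (inr i) == c) = false.
    by have := enum_valP (cast_ord (esym (cardC1 c)) i); rewrite !inE => /negbTE.
  have g_inj : injective g.
    move=> [i|i] [j|j] gE.
    - by rewrite (ord1 i) (ord1 j).
    - by have := g_inr j; rewrite -gE eqxx.
    - by have := g_inr i; rewrite gE eqxx.
    - by congr inr; apply: cast_ord_inj (enum_val_inj gE).
  have [|f gK fK] := inj_card_bij g_inj.
    by rewrite card_sum !card_ord add1n prednK.
  exists f => [|x y]; first by exists g.
  rewrite -{1}(fK x) -{1}(fK y) eE.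
  by case: (f x) => i; case: (f y) => j; rewrite ?g_inr ?eqxx.
exists (g (inl ord0)) => x y; rewrite eE -!(can2_eq fK gK).
by case: (f x) => i; case: (f y) => j; rewrite /eq_op /= ?(ord1 i) ?(ord1 j).
Qed.

End Star.

(** * The bound and its equality case over the integers *)

Theorem theorem3p2 (V : finType) (e : rel V) (n : nat)
    (hT : is_tree e) (hV : #|V| = n) (hn : 3 <= n) :
  ((xi_d e)%:Z - (xi_c e)%:Z >= 4 * n%:Z ^+ 2 - 12 * n%:Z + 8)%R
  /\ (((xi_d e)%:Z - (xi_c e)%:Z = 4 * n%:Z ^+ 2 - 12 * n%:Z + 8)%R
      <-> graph_iso e (star n)).
Proof.
(* The bound factors as 4(n - 1)(n - 2), and [3 <= n] keeps the predecessors exact. *)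
have boundE : (4 * n%:Z ^+ 2 - 12 * n%:Z + 8 = (4 * (n.-1 * n.-2))%N%:Z)%R.
  by case: n hn {hV} => [|[|m]] // _ /=; lia.
have xi_le := tree_xi hT; have xi_eq := @tree_xi_eq _ _ hT.
rewrite hV in xi_le xi_eq; rewrite boundE; split; first by lia.
split=> [xiE|isoV].
  rewrite -hV; apply: proj2 _; apply/star_isoP/(diam2_tree_star hT)/xi_eq; lia.
have [|c starV] := (star_isoP e).2;
  first by rewrite hV; split=> //; apply: leq_trans hn.
have [_ [_ connV] _] := hT; have := star_xi starV connV; rewrite hV; lia.
Qed.
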